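(* Let $H \in M_n$ be Hermitian, and let $P^+$ and $P^-$ be the orthogonal projections onto its strictly positive and strictly negative eigenspaces, respectively. Then the following are equivalent: (a) $H$ is Birkhoff--James orthogonal in the trace norm to every positive semidefinite diagonal matrix in $M_n$. (b) $H$ is Birkhoff--James orthogonal in the trace norm to $\mathbf{e}_j\mathbf{e}_j^*$ for all $1\le j\le n$. (c) $P^+_{j,j}\le 1/2$ and $P^-_{j,j}\le 1/2$ for all $1\le j\le n$.
   Context: $M_n$ is the set of $n\times n$ complex matrices; $\mathbf{e}_1,\dots,\mathbf{e}_n$ is the standard basis of $\mathbb{C}^n$; $A_{i,j}$ is the $(i,j)$-entry of $A$. The trace norm $\|A\|_{\mathrm{tr}}$ is the sum of the singular values of $A$. For Hermitian $A,B\in M_n$, $A$ is Birkhoff--James orthogonal to $B$ (in the trace norm) if $\|A\|_{\mathrm{tr}} \le \|A+\lambda B\|_{\mathrm{tr}}$ for all $\lambda\in\mathbb{R}$. The ''strictly positive (resp. negative) eigenspace'' of a Hermitian matrix means the direct sum of all its eigenspaces corresponding to strictly positive (resp. negative) eigenvalues. *)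

(* Defs.v *)
(* The complex numbers are R[i] for R : realType. *)
From mathcomp Require Export all_boot all_order all_algebra.
From mathcomp Require Export sesquilinear spectral.
From mathcomp Require Export complex.
From mathcomp Require Export reals.

Set Implicit Arguments.
Unset Strict Implicit.
Unset Printing Implicit Defensive.

Import Order.TTheory GRing.Theory Num.Theory.
Local Open Scope ring_scope.
Local Open Scope complex_scope.
Local Open Scope sesquilinear_scope.

(* The eigenvalues of A, listed with algebraic multiplicity. *)
Definition eigenvalues (C : numClosedFieldType) (n : nat) (A : 'M[C]_n) :
    seq C :=
  sval (closed_field_poly_normal (char_poly A)).

(* The singular values of A are the square roots of the eigenvalues of A^* A.
   The value is a real number seen in C, where the order compares real
   numbers as usual. *)
Definition trace_norm (C : numClosedFieldType) (n : nat) (A : 'M[C]_n) : C :=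
  \sum_(s <- eigenvalues (A ^t* *m A)) sqrtC s.

Definition bj_orthogonal (R : realType) (n : nat) (A B : 'M[R[i]]_n) : Prop :=
  forall lambda : R, trace_norm A <= trace_norm (A + lambda%:C *: B).

(* In R[i], 0 <= z means that z is real and nonnegative. *)
Definition psdmx (C : numClosedFieldType) (n : nat) (A : 'M[C]_n) : Prop :=
  A \is hermsymmx /\
  forall x : 'cV[C]_n, 0 <= (x ^t* *m A *m x) 0 0.

(* Repetitions in [eigenvalues H] are harmless here, as the sum is a sum of
   subspaces.  [eigenspace] and [proj_ortho] are about row vectors u, with
   u *m H = a *: u and u |-> u *m P.  For Hermitian H, the row eigenvectors are
   the conjugate transposes of the column eigenvectors, and since an orthogonal
   projection is Hermitian, the matrix P is the same in both conventions. *)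
Definition pos_eigenspace (C : numClosedFieldType) (n : nat) (H : 'M[C]_n) :
    'M[C]_n :=
  (\sum_(a <- eigenvalues H | (0 < a)%R) eigenspace H a)%MS.

Definition neg_eigenspace (C : numClosedFieldType) (n : nat) (H : 'M[C]_n) :
    'M[C]_n :=
  (\sum_(a <- eigenvalues H | (a < 0)%R) eigenspace H a)%MS.

Definition pos_proj (C : numClosedFieldType) (n : nat) (H : 'M[C]_n) :
    'M[C]_n := proj_ortho (pos_eigenspace H).

Definition neg_proj (C : numClosedFieldType) (n : nat) (H : 'M[C]_n) :
    'M[C]_n := proj_ortho (neg_eigenspace H).

Definition basis_vec (C : numClosedFieldType) (n : nat) (j : 'I_n) : 'cV[C]_n :=
  delta_mx j 0.

(* Main.v *)
(* For Hermitian A the trace norm is the maximum of |tr (U A)| over Hermitian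
   contractions U, and the minimum of tr X + tr Y over decompositions A = X - Y
   into positive semidefinite matrices.  Given (c) and a nonnegative diagonal D,
   testing H + l D with U = 1 - 2 P^- (for l >= 0) or U = 2 P^+ - 1 (for l < 0)
   gives |H + l D| >= |H| + |l| sum_j D_jj (1 - 2 P_jj) >= |H|, whence (a).
   Conversely, if P^-_jj > 1/2, put u = e_j and q = u - P^- u.  For
   small l, t > 0 the matrices X = H^+ + l (1 + t) q q^* and
   Y = H^- + l ((1 + t) q q^* - u u^* ) are positive semidefinite with
   X - Y = H + l u u^*, and tr X + tr Y < |H| because |q|^2 = 1 - P^-_jj < 1/2.
   The case of P^+ is that of P^- for - H. *)
Require Import Defs.
From mathcomp Require Import ring.
Import Order.TTheory GRing.Theory Num.Theory.
Local Open Scope ring_scope.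
Local Open Scope complex_scope.
Local Open Scope sesquilinear_scope.

(** * Adjoints and matrices diagonalised by a unitary matrix *)

Section UnitaryDiagonal.
Set Implicit Arguments.
Unset Strict Implicit.
Variable C : numClosedFieldType.

(** For unitary [W], the rows of [W] are left eigenvectors with eigenvalues [d i]. Keeping [W] fixed
    and [d] a function makes functional calculus act on [d] alone. *)
Definition sdiag n (W : 'M[C]_n) (d : 'I_n -> C) : 'M[C]_n :=
  W^t* *m diag_mx (\row_i d i) *m W.

Lemma adjmxM m n p (A : 'M[C]_(m, n)) (B : 'M[C]_(n, p)) :
  (A *m B)^t* = B^t* *m A^t*.
Proof. by rewrite trmx_mul map_mxM. Qed.

Lemma adjmxD m n (A B : 'M[C]_(m, n)) : (A + B)^t* = A^t* + B^t*.
Proof. by rewrite linearD map_mxD. Qed.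

Lemma adjmxN m n (A : 'M[C]_(m, n)) : (- A)^t* = - A^t*.
Proof. by rewrite linearN map_mxN. Qed.

Lemma adjmxZ m n a (A : 'M[C]_(m, n)) : (a *: A)^t* = a^* *: A^t*.
Proof. by rewrite linearZ map_mxZ. Qed.

Lemma hermsymmxP n (A : 'M[C]_n) : reflect (A^t* = A) (A \is hermsymmx).
Proof.
by rewrite qualifE /= expr0 scale1r eq_sym; apply: eqP.
Qed.

Lemma unitarymxC n (W : 'M[C]_n) : W \is unitarymx -> W^t* *m W = 1%:M.
Proof. by move=> /unitarymxP /mulmx1C. Qed.

Lemma sdiagN n (W : 'M[C]_n) d : sdiag W (fun i => - d i) = - sdiag W d.
Proof.
rewrite /sdiag -mulNmx -mulmxN -linearN /=; congr (_ *m diag_mx _ *m _).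
by apply/rowP=> i; rewrite !mxE.
Qed.

Lemma sdiagD n (W : 'M[C]_n) d e :
  sdiag W (fun i => d i + e i) = sdiag W d + sdiag W e.
Proof.
rewrite /sdiag -mulmxDl -mulmxDr -linearD /=; congr (_ *m diag_mx _ *m _).
by apply/rowP=> i; rewrite !mxE.
Qed.

Lemma sdiagZ n (W : 'M[C]_n) a d :
  sdiag W (fun i => a * d i) = a *: sdiag W d.
Proof.
rewrite /sdiag scalemxAl scalemxAr -linearZ /=; congr (_ *m diag_mx _ *m _).
by apply/rowP=> i; rewrite !mxE.
Qed.

Lemma sdiagM n (W : 'M[C]_n) d e : W \is unitarymx ->
  sdiag W d *m sdiag W e = sdiag W (fun i => d i * e i).
Proof.
move=> uW; rewrite /sdiag !mulmxA mulmxtVK //.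
rewrite -[_ *m diag_mx _ *m diag_mx _]mulmxA.
rewrite mulmx_diag; congr (_ *m diag_mx _ *m _).
by apply/rowP=> i; rewrite !mxE.
Qed.

Lemma sdiag_adj n (W : 'M[C]_n) d :
  (forall i, d i \is Num.real) -> (sdiag W d)^t* = sdiag W d.
Proof.
move=> dR; rewrite /sdiag !adjmxM trmxCK mulmxA tr_diag_mx map_diag_mx.
congr (_ *m diag_mx _ *m _); apply/rowP=> i; rewrite !mxE.
exact/CrealP.
Qed.

Lemma sdiag_diag_real n (W : 'M[C]_n) d j :
  (forall i, d i \is Num.real) -> sdiag W d j j \is Num.real.
Proof.
by move=> dR; apply/CrealP; rewrite -[in RHS]sdiag_adj // !mxE.
Qed.

Lemma sdiag1 n (W : 'M[C]_n) : W \is unitarymx -> sdiag W (fun=> 1) = 1%:M.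
Proof.
move=> uW; rewrite /sdiag -(unitarymxC uW).
suff -> : diag_mx (\row_(i < n) 1) = 1%:M :> 'M[C]_n by rewrite mulmx1.
by apply/matrixP=> i j; rewrite !mxE.
Qed.

Lemma eq_sdiag n (W : 'M[C]_n) d e : d =1 e -> sdiag W d = sdiag W e.
Proof.
by move=> de; congr (_ *m diag_mx _ *m _); apply/rowP=> i; rewrite !mxE.
Qed.

Lemma mxtrace_sdiagM n (W : 'M[C]_n) d (A : 'M[C]_n) :
  \tr (sdiag W d *m A) = \sum_i d i * (W *m A *m W^t*) i i.
Proof.
rewrite /sdiag -!mulmxA mxtrace_mulC -!mulmxA.
by apply: eq_bigr => i _; rewrite mul_diag_mx mxE mxE mulmxA.
Qed.

Lemma mxtrace_sdiag n (W : 'M[C]_n) d : W \is unitarymx ->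
  \tr (sdiag W d) = \sum_i d i.
Proof.
move=> uW; rewrite -[sdiag W d]mulmx1 mxtrace_sdiagM mulmx1 (unitarymxP uW).
by apply: eq_bigr => i _; rewrite mxE eqxx mulr1.
Qed.

Lemma hermitian_sdiag n (A : 'M[C]_n) : A \is hermsymmx ->
  exists W d, [/\ W \is unitarymx, forall i, d i \is Num.real & A = sdiag W d].
Proof.
move=> hA; exists (spectralmx A), (spectral_diag A 0).
split; first exact: spectral_unitarymx.
  by move=> i; have /mxOverP := hermitian_spectral_diag_real hA; apply.
have /hermitian_normalmx/orthomx_spectralP {1}-> := hA.
rewrite invmx_unitary ?spectral_unitarymx //.
by congr (_ *m diag_mx _ *m _); apply/rowP=> i; rewrite !mxE.
Qed.

(** * Spectrum, trace norm and spectral projections *)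

Lemma char_poly_sdiag n (W : 'M[C]_n) d : W \is unitarymx ->
  char_poly (sdiag W d) = \prod_i ('X - (d i)%:P).
Proof.
move=> uW; have uWC := unitarymxC uW.
have -> : char_poly (sdiag W d) = char_poly (diag_mx (\row_i d i)).
  rewrite /char_poly /char_poly_mx /sdiag !map_mxM /=.
  have eW : map_mx polyC (W^t*) *m map_mx polyC W = 1%:M.
    by rewrite -map_mxM uWC map_mx1.
  (* The scalar matrix ['X%:M] commutes with everything, so the whole characteristic matrix is a
     conjugate by [W] and the determinants of [W] cancel. *)
  have eX : 'X%:M = map_mx polyC (W^t*) *m 'X%:M *m map_mx polyC W.
    by rewrite scalar_mxC -mulmxA eW mulmx1.
  rewrite [in LHS]eX -mulmxBl -mulmxBr !det_mulmx mulrC mulrA -det_mulmx.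
  by rewrite (mulmx1C eW) det1 mul1r.
rewrite char_poly_trig; last exact: diag_mx_is_trig.
by apply: eq_bigr => i _; rewrite !mxE eqxx mulr1n.
Qed.

Lemma eigenvalues_sdiag n (W : 'M[C]_n) d : W \is unitarymx ->
  perm_eq (eigenvalues (sdiag W d)) [seq d i | i <- enum 'I_n].
Proof.
move=> uW; apply: prod_XsubC_eq.
rewrite /eigenvalues; case: closed_field_poly_normal => s /=.
rewrite (monicP (char_poly_monic _)) scale1r char_poly_sdiag // => <-.
by rewrite big_map big_enum.
Qed.

Lemma trace_norm_sdiag n (W : 'M[C]_n) d : W \is unitarymx ->
  (forall i, d i \is Num.real) -> trace_norm (sdiag W d) = \sum_i `|d i|.
Proof.
move=> uW dR; rewrite /trace_norm sdiag_adj // sdiagM //.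
rewrite (perm_big _ (eigenvalues_sdiag _ uW)) big_map big_enum /=.
by apply: eq_bigr => i _; rewrite -expr2 -real_normK // sqrCK.
Qed.

Lemma trace_normN n (A : 'M[C]_n) : trace_norm (- A) = trace_norm A.
Proof. by rewrite /trace_norm adjmxN mulNmx mulmxN opprK. Qed.

(** It suffices to compare both sides on the rows of [W]: a row with [p (d i)] lies in the sum and
    is fixed; any other row is orthogonal to every summand and is killed. *)
Lemma proj_ortho_sdiag n (W : 'M[C]_n) d (p : pred C) :
  W \is unitarymx -> (forall i, d i \is Num.real) ->
  let H := sdiag W d in
  proj_ortho (\sum_(a <- eigenvalues H | p a) eigenspace H a)%MS =
  sdiag W (fun i => (p (d i))%:R).
Proof.
move=> uW dR H; set S := (\sum_(a <- _ | _) _)%MS.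
have HH : H^t* = H := sdiag_adj W dR.
have rowWH i : row i W *m H = d i *: row i W.
  rewrite -row_mul /H /sdiag !mulmxA (unitarymxP uW) mul1mx.
  by apply/rowP=> j; rewrite mul_diag_mx !mxE.
suff WP : W *m proj_ortho S = diag_mx (\row_i (p (d i))%:R) *m W.
  by rewrite /sdiag -mulmxA -WP mulmxA (unitarymxC uW) mul1mx.
apply/row_matrixP=> i.
rewrite row_mul; have -> : row i (diag_mx (\row_k (p (d k))%:R) *m W) =
    (p (d i))%:R *: row i W.
  by apply/rowP=> j; rewrite mul_diag_mx !mxE.
case: (boolP (p (d i))) => [pdi|npdi].
  rewrite scale1r proj_ortho_id // /S (big_rem (d i)) /=; last first.
    by rewrite (perm_mem (eigenvalues_sdiag _ uW)) map_f // mem_enum.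
  rewrite pdi (submx_trans _ (addsmxSl _ _)) //.
  exact/eigenspaceP.
rewrite scale0r proj_ortho_0 // orthomx_sym /S.
apply: (big_ind (fun X => (X <= _)%MS)); first exact: sub0mx.
  by move=> A B; rewrite addsmx_sub => -> ->.
move=> a pa; apply/orthomx1P.
have /eigenspaceP eE := submx_refl (eigenspace H a).
set E := eigenspace H a in eE *.
(* Eigenvectors of a Hermitian matrix for distinct eigenvalues are orthogonal:
   [E *m H *m (row i W)^t*] is computed in two ways. *)
have : a *: (E *m (row i W)^t*) = d i *: (E *m (row i W)^t*).
  rewrite scalemxAl -eE -mulmxA -{1}HH -adjmxM rowWH.
  by rewrite adjmxZ (CrealP (dR i)) scalemxAr.
move/eqP; rewrite -subr_eq0 -scalerBl scaler_eq0 subr_eq0.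
by case/orP=> /eqP // aE; rewrite aE (negPf npdi) in pa.
Qed.

(** * Lower bounds on the trace norm by duality *)

(** The entry is an average of the [s i] with weights [|V i k|^2], which sum to 1 because the
    columns of [V] are unit vectors. *)
Lemma norm_sdiag_diag_le1 n (V : 'M[C]_n) s k : V \is unitarymx ->
  (forall i, `|s i| <= 1) -> `|sdiag V s k k| <= 1.
Proof.
move=> uV s1; rewrite /sdiag mul_mx_diag mxE.
have /matrixP/(_ k k) := unitarymxC uV; rewrite !mxE eqxx mulr1n => <-.
apply: le_trans (ler_norm_sum _ _ _) _; apply: ler_sum => i _.
rewrite !mxE -mulrA (mulrC (s i)) mulrA normrM.
rewrite [`|_^* * _|]ger0_norm; last by rewrite mulrC mul_conjC_ge0.
by rewrite ler_piMr // mulrC mul_conjC_ge0.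
Qed.

(** In an eigenbasis of [A] the trace is the sum of the eigenvalues of [A] weighted by diagonal
    entries of a conjugate of [sdiag W s], each of modulus at most 1. *)
Lemma norm_mxtrace_le_trace_norm n (W A : 'M[C]_n) s : W \is unitarymx ->
  (forall i, `|s i| <= 1) -> A \is hermsymmx ->
  `|\tr (sdiag W s *m A)| <= trace_norm A.
Proof.
move=> uW s1 /hermitian_sdiag[V [d [uV dR ->]]].
rewrite mxtrace_mulC mxtrace_sdiagM trace_norm_sdiag //.
apply: le_trans (ler_norm_sum _ _ _) _; apply: ler_sum => i _.
rewrite normrM ler_piMr //.
have -> : V *m sdiag W s *m V^t* = sdiag (W *m V^t*) s.
  by rewrite /sdiag adjmxM trmxCK !mulmxA.
by apply: norm_sdiag_diag_le1 => //; rewrite mul_unitarymx // trmxC_unitary.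
Qed.

(** * Positive semidefinite matrices and upper bounds on the trace norm *)

Lemma psdmxD n (A B : 'M[C]_n) : psdmx A -> psdmx B -> psdmx (A + B).
Proof.
move=> [/hermsymmxP hA pA] [/hermsymmxP hB pB]; split.
  by apply/hermsymmxP; rewrite adjmxD hA hB.
by move=> x; rewrite mulmxDr mulmxDl mxE addr_ge0.
Qed.

Lemma psdmxZ n a (A : 'M[C]_n) : 0 <= a -> psdmx A -> psdmx (a *: A).
Proof.
move=> a0 [/hermsymmxP hA pA]; split.
  apply/hermsymmxP; rewrite adjmxZ hA.
  by rewrite (CrealP (ger0_real a0)).
by move=> x; rewrite -scalemxAr -scalemxAl mxE mulr_ge0.
Qed.

Lemma form_outer n (x u : 'cV[C]_n) :
  (x^t* *m (u *m u^t*) *m x) 0 0 = `|(x^t* *m u) 0 0| ^+ 2.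
Proof.
rewrite mulmxA -mulmxA -[X in _ *m (_ *m X)](trmxCK x) -adjmxM mxE big_ord1.
by rewrite normCK !mxE.
Qed.

Lemma outer_adj n (u : 'cV[C]_n) : (u *m u^t*)^t* = u *m u^t*.
Proof. by rewrite adjmxM trmxCK. Qed.

Lemma psdmx_outer n (u : 'cV[C]_n) : psdmx (u *m u^t*).
Proof.
split; first by apply/hermsymmxP; exact: outer_adj.
by move=> x; rewrite form_outer exprn_ge0.
Qed.

Lemma psdmx_sdiag n (W : 'M[C]_n) d : (forall i, 0 <= d i) ->
  psdmx (sdiag W d).
Proof.
move=> d0; split.
  by apply/hermsymmxP/sdiag_adj => i; exact: ger0_real.
move=> x; rewrite /sdiag !mulmxA -adjmxM -mulmxA mul_mx_diag mxE.
by apply: sumr_ge0 => i _; rewrite !mxE mulrAC mulr_ge0 // mulrC mul_conjC_ge0.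
Qed.

Lemma psdmx_conj_diag_ge0 n (W X : 'M[C]_n) i : psdmx X ->
  0 <= (W *m X *m W^t*) i i.
Proof.
move=> [_ /(_ ((row i W)^t*))]; rewrite trmxCK -row_mul.
suff -> : (row i (W *m X) *m (row i W)^t*) 0 0 = (W *m X *m W^t*) i i by [].
by rewrite !mxE; apply: eq_bigr => k _; rewrite !mxE.
Qed.

(** In an eigenbasis of [X - Y] each eigenvalue is a difference of nonnegative diagonal entries of
    [X] and [Y], so its modulus is at most their sum. *)
Lemma trace_norm_sub_le n (X Y : 'M[C]_n) : psdmx X -> psdmx Y ->
  trace_norm (X - Y) <= \tr X + \tr Y.
Proof.
move=> pX pY; have [/hermsymmxP hX _] := pX; have [/hermsymmxP hY _] := pY.
have /hermitian_sdiag[W [d [uW dR eA]]] : X - Y \is hermsymmx.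
  by apply/hermsymmxP; rewrite adjmxD adjmxN hX hY.
have trW Z : \tr Z = \sum_i (W *m Z *m W^t*) i i.
  by rewrite -[RHS]/(\tr _) mxtrace_mulC mulmxA (unitarymxC uW) mul1mx.
rewrite eA trace_norm_sdiag // (trW X) (trW Y) -big_split /=.
apply: ler_sum => i _.
have -> : d i = (W *m X *m W^t*) i i - (W *m Y *m W^t*) i i.
  have -> : (W *m X *m W^t*) i i - (W *m Y *m W^t*) i i =
      (W *m (X - Y) *m W^t*) i i by rewrite mulmxBr mulmxBl !mxE.
  rewrite eA /sdiag !mulmxA (unitarymxP uW) mul1mx mulmxtVK //.
  by rewrite !mxE eqxx mulr1n.
rewrite (le_trans (ler_normB _ _)) // !ger0_norm //; exact: psdmx_conj_diag_ge0.
Qed.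

(* With a = x^* q and b = x^* P u, this combines the weighted inequality
   |a + b|^2 <= (1 + t) |a|^2 + (1 + 1/t) |b|^2 with |b|^2 <= x^* P x. *)
Lemma rank1_le_proj n (P : 'M[C]_n) (u : 'cV[C]_n) (t : C) :
  P^t* = P -> P *m P = P -> u^t* *m u = 1%:M -> 0 < t ->
  let q := u - P *m u in
  psdmx ((1 + t^-1) *: P + (1 + t) *: (q *m q^t*) - u *m u^t*).
Proof.
move=> hP PP uu t0 q; have tR := gtr0_real t0.
have t'R : t^-1 \is Num.real by rewrite realV.
split.
  apply/hermsymmxP; rewrite adjmxD adjmxN adjmxD !adjmxZ.
  by rewrite hP !outer_adj !rmorphD rmorph1 /= (CrealP tR) (CrealP t'R).
move=> x; set a := (x^t* *m q) 0 0; set b := (x^t* *m (P *m u)) 0 0.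
set s := (x^t* *m P *m x) 0 0.
have -> : (x^t* *m ((1 + t^-1) *: P + (1 + t) *: (q *m q^t*) - u *m u^t*) *m x)
    0 0 = (1 + t^-1) * s + (1 + t) * `|a| ^+ 2 - `|a + b| ^+ 2.
  have -> : a + b = (x^t* *m u) 0 0.
    by rewrite /a /b /q mulmxBr !mxE subrK.
  rewrite -form_outer -form_outer mulmxBr mulmxBl mulmxDr mulmxDl.
  rewrite -!scalemxAr -!scalemxAl /s.
  move: (_ *m P *m x) (_ *m (q *m _) *m x) (_ *m (u *m _) *m x) => A B D.
  by rewrite !mxE.
(* The squared norm of [z - b *: u^t*] equals [s - |b|^2], since [u] is a unit vector. *)
have sb : `|b| ^+ 2 <= s.
  pose z := x^t* *m P; have zu : z *m u = b%:M.
    by rewrite [LHS]mx11_scalar /b /z mulmxA.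
  have zz : z *m z^t* = s%:M.
    rewrite adjmxM trmxCK hP /z mulmxA -[_ *m P *m P]mulmxA PP.
    by rewrite [LHS]mx11_scalar.
  have : 0 <= ((z - b *: u^t*) *m (z - b *: u^t*)^t*) 0 0.
    by rewrite -dotmxE dnorm_ge0.
  rewrite adjmxD adjmxN adjmxZ trmxCK mulmxBr !mulmxBl.
  rewrite -!scalemxAr -!scalemxAl zu zz uu -adjmxM zu !mxE.
  rewrite !mulr1n normCK.
  by rewrite mulr1 mulrC subrr subr0 subr_ge0.
(* Completing the square leaves two visibly nonnegative terms. *)
have -> : (1 + t^-1) * s + (1 + t) * `|a| ^+ 2 - `|a + b| ^+ 2 =
    (1 + t^-1) * (s - `|b| ^+ 2) + t^-1 * `|t * a - b| ^+ 2.
  rewrite !normCK !rmorphD rmorphN rmorphM /= (CrealP tR).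
  by field; rewrite gt_eqF.
rewrite addr_ge0 // mulr_ge0 ?exprn_ge0 ?subr_ge0 ?invr_ge0 ?(ltW t0) //.
by rewrite addr_ge0 ?invr_ge0 ?(ltW t0).
Qed.

(** Pythagoras: the trace is [|q|^2], where [q] is the component of [u] orthogonal to the range of
    [P]. *)
Lemma mxtrace_outer_residual n (P : 'M[C]_n) (u : 'cV[C]_n) :
  P^t* = P -> P *m P = P ->
  let q := u - P *m u in
  \tr (q *m q^t*) = (u^t* *m u) 0 0 - (u^t* *m P *m u) 0 0.
Proof.
move=> hP PP q; rewrite mxtrace_mulC /q adjmxD adjmxN adjmxM hP.
rewrite mulmxBr !mulmxBl !mulmxA -[_ *m P *m P]mulmxA PP subrr subr0.
by rewrite raddfB /= [X in X - _]trace_mx11 [X in _ - X]trace_mx11.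
Qed.

(** * Effect of diagonal perturbations on the trace norm *)

(** A spectral gap below 0. The inverse of 1 plus a sum of inverses replaces a minimum, and still
    makes sense when no [d i] is negative. *)
Lemma exists_lower_bound n (d : 'I_n -> C) :
  exists2 e, 0 < e & forall i, d i < 0 -> e <= - d i.
Proof.
pose f i := if d i < 0 then (- d i)^-1 else 0.
have f0 i : 0 <= f i.
  by rewrite /f; case: ifP => // di; rewrite invr_ge0 oppr_ge0 ltW.
have s0 : 0 < 1 + \sum_i f i by rewrite ltr_pwDl // sumr_ge0.
exists (1 + \sum_i f i)^-1 => [|i di]; first by rewrite invr_gt0.
rewrite -[leRHS]invrK lef_pV2 ?posrE ?invr_gt0 ?oppr_gt0 //.
rewrite (bigD1 i) //= {1}/f di addrCA lerDl addr_ge0 //.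
by rewrite sumr_ge0.
Qed.

Lemma real_natb (b : bool) : (b%:R : C) \is Num.real.
Proof. exact: realn. Qed.

Lemma trace_norm_add_outer_lt n (W : 'M[C]_n) d j : W \is unitarymx ->
  (forall i, d i \is Num.real) ->
  1 / 2 < sdiag W (fun i => (d i < 0)%R%:R) j j ->
  exists2 l, 0 < l &
    trace_norm (sdiag W d + l *: (basis_vec C j *m (basis_vec C j)^t*)) <
    trace_norm (sdiag W d).
Proof.
move=> uW dR; set N := sdiag W _; set u := basis_vec C j; set c := N j j => c2.
have hN : N^t* = N by apply: sdiag_adj => i; exact: real_natb.
have NN : N *m N = N.
  by rewrite /N sdiagM //; apply: eq_sdiag => i; rewrite -natrM mulnb andbb.
have uE : u^t* = delta_mx 0 j by rewrite /u /basis_vec trmx_delta map_delta_mx.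
have uu : u^t* *m u = 1%:M.
  by rewrite uE /u mul_delta_mx [LHS]mx11_scalar mxE !eqxx.
have uNu : u^t* *m N *m u = c%:M.
  by rewrite uE -rowE -colE [LHS]mx11_scalar mxE mxE.
have [e e0 de] := exists_lower_bound d.
(* As 2 (1 + t) (1 - c) = 1 - t^2, the trace norm drops by l t^2. *)
have [t tE] : exists t, t = 2 * c - 1 by eexists.
have t0 : 0 < t by rewrite tE subr_gt0 mulrC -ltr_pdivrMr.
have t1 : 0 <= 1 + t by exact: addr_ge0 ler01 (ltW t0).
pose q := u - N *m u.
have trq : \tr (q *m q^t*) = 1 - c.
  by rewrite mxtrace_outer_residual // uu uNu ![_%:M _ _]mxE eqxx !mulr1n.
have r0 : 0 < 1 + t^-1 by rewrite addr_gt0 ?invr_gt0.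
(* With this [l], the term [l * (1 + t^-1)] times [N] fits under the negative part of [sdiag W d],
   by the gap [e]. *)
have [l [l0 lE]] : exists l, 0 < l /\ l * (1 + t^-1) = e.
  by exists (e / (1 + t^-1)); rewrite divr_gt0 // divfK ?gt_eqF.
exists l => //.
pose X := sdiag W (fun i => (0 < d i)%R%:R * d i) +
  (l * (1 + t)) *: (q *m q^t*).
pose Y := sdiag W (fun i => (d i < 0)%R%:R * - d i) +
  l *: ((1 + t) *: (q *m q^t*) - u *m u^t*).
have pX : psdmx X.
  apply: psdmxD; last first.
    by apply: psdmxZ (psdmx_outer q); rewrite mulr_ge0 ?(ltW l0).
  apply: psdmx_sdiag => i; case: (boolP (0 < d i)) => [/ltW|_].
    by rewrite mul1r.
  by rewrite mul0r.
have pY : psdmx Y.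
  (* Moving [e *: N] out of the negative part keeps that part nonnegative and supplies the multiple
     of [N] that [rank1_le_proj] needs. *)
  have -> : Y = sdiag W (fun i => (d i < 0)%R%:R * (- d i - e)) +
      l *: ((1 + t^-1) *: N + (1 + t) *: (q *m q^t*) - u *m u^t*).
    rewrite /Y -addrA [in RHS]scalerDr scalerA lE [RHS]addrA.
    congr (_ + _); rewrite /N -sdiagZ -sdiagD.
    by apply: eq_sdiag => i; ring.
  apply: psdmxD; last first.
    by apply: psdmxZ; [rewrite ltW | exact: rank1_le_proj].
  apply: psdmx_sdiag => i; case: (boolP (d i < 0)) => [/de|_].
    by rewrite mul1r subr_ge0.
  by rewrite mul0r.
have sgn i : `|d i| = (0 < d i)%R%:R * d i + (d i < 0)%R%:R * - d i.
  case: (real_ltgt0P (dR i)) => _; rewrite ?mul1r ?mul0r ?addr0 ?add0r //.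
have -> : sdiag W d + l *: (u *m u^t*) = X - Y.
  rewrite /X /Y scalerBr scalerA.
  have -> : sdiag W d = sdiag W (fun i => (0 < d i)%R%:R * d i) -
      sdiag W (fun i => (d i < 0)%R%:R * - d i).
    rewrite -sdiagN -sdiagD; apply: eq_sdiag => i.
    by case: (real_ltgt0P (dR i)) => [_|_|->]; rewrite /=; ring.
  set A := sdiag W _; set B := sdiag W _; set Q := _ *: (q *m _).
  by rewrite !opprD opprK addrACA addNKr.
apply: le_lt_trans (trace_norm_sub_le pX pY) _.
rewrite trace_norm_sdiag // (eq_bigr _ (fun i _ => sgn i)) big_split /=.
rewrite /X /Y !mxtraceD !mxtraceZ [\tr (_ - _)]raddfB /= mxtraceZ.
rewrite !mxtrace_sdiag // trq [\tr (u *m _)]mxtrace_mulC uu mxtrace1.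
set S := \sum_i _; set T := \sum_i _.
rewrite -subr_gt0.
have -> : S + T - (S + l * (1 + t) * (1 - c) +
      (T + l * ((1 + t) * (1 - c) - 1))) =
    l * t ^+ 2 by rewrite tE; ring.
by rewrite mulr_gt0 ?exprn_gt0.
Qed.

Lemma trace_norm_add_diag_ge n (W D : 'M[C]_n) d l : W \is unitarymx ->
  (forall i, d i \is Num.real) ->
  (forall j, sdiag W (fun i => (d i < 0)%R%:R) j j <= 1 / 2) ->
  is_diag_mx D -> psdmx D -> 0 <= l ->
  trace_norm (sdiag W d) <= trace_norm (sdiag W d + l *: D).
Proof.
move=> uW dR; set N := sdiag W _ => N2 diagD pD l0.
have [/hermsymmxP hD _] := pD.
(* A sign function with value 1 at zero eigenvalues, so that the diagonal of [sdiag W s] depends on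
   that of [N] only. *)
pose s i : C := 1 - 2 * (d i < 0)%R%:R.
have sdE i : s i * d i = `|d i|.
  by rewrite /s; case: (real_ltgt0P (dR i)) => [_|_|->]; rewrite /=; ring.
have s1 i : `|s i| <= 1.
  rewrite /s; case: (d i < 0); rewrite ?mulr1 ?mulr0 ?subr0 ?normr1 //.
  by rewrite [1 - 2](_ : _ = -1) ?normrN1 //; ring.
have sE : sdiag W s = 1%:M - 2 *: N.
  by rewrite -(sdiag1 uW) /N -sdiagZ -sdiagN -sdiagD.
have D0 j : 0 <= D j j.
  have := psdmx_conj_diag_ge0 1%:M j pD.
  by rewrite trmx1 map_mx1 mul1mx mulmx1.
(* As [D] is diagonal, the trace is the sum of [(1 - 2 * N j j) * D j j]. *)
have trD : 0 <= \tr (sdiag W s *m D).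
  apply: sumr_ge0 => j _; rewrite mxE (bigD1 j) //= big1 ?addr0 => [|k kj].
    rewrite mulr_ge0 // sE [leRHS]mxE [1%:M _ _]mxE eqxx.
    by rewrite [X in _ + X]mxE [X in _ - X]mxE subr_ge0 mulrC -ler_pdivlMr.
  by rewrite (is_diag_mxP diagD) ?mulr0.
have trE : \tr (sdiag W s *m (sdiag W d + l *: D)) =
    trace_norm (sdiag W d) + l * \tr (sdiag W s *m D).
  rewrite mulmxDr mxtraceD -scalemxAr mxtraceZ sdiagM // mxtrace_sdiag //.
  by rewrite trace_norm_sdiag //; congr (_ + _); apply: eq_bigr.
have hA : sdiag W d + l *: D \is hermsymmx.
  by apply/hermsymmxP; rewrite adjmxD adjmxZ hD sdiag_adj //
    (CrealP (ger0_real l0)).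
apply: le_trans (norm_mxtrace_le_trace_norm uW s1 hA).
rewrite trE; apply: le_trans (real_ler_norm _); first by rewrite lerDl mulr_ge0.
by rewrite realD ?ger0_real ?mulr_ge0 // trace_norm_sdiag // sumr_ge0.
Qed.

End UnitaryDiagonal.

Theorem theorem3 (R : realType) (n : nat) (H : 'M[R[i]]_n)
    (hH : H \is hermsymmx) :
  let condA := forall D : 'M[R[i]]_n,
    is_diag_mx D -> psdmx D -> bj_orthogonal H D in
  let condB := forall j : 'I_n,
    bj_orthogonal H (basis_vec R[i] j *m (basis_vec R[i] j) ^t*) in
  let condC := forall j : 'I_n,
    pos_proj H j j <= 1 / 2 /\ neg_proj H j j <= 1 / 2 in
  (condA <-> condB) /\ (condB <-> condC).
Proof.
move=> condA condB condC.
have [W [d [uW dR eH]]] := hermitian_sdiag hH.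
(* Written as the negative projection of [- H], so that both perturbation lemmas apply to [- H] as
   they stand. *)
have posE : pos_proj H = sdiag W (fun i => (- d i < 0)%R%:R).
  rewrite eH /pos_proj /pos_eigenspace proj_ortho_sdiag //.
  by apply: eq_sdiag => i; rewrite oppr_lt0.
have negE : neg_proj H = sdiag W (fun i => (d i < 0)%R%:R).
  by rewrite eH /neg_proj /neg_eigenspace proj_ortho_sdiag.
have NdR i : - d i \is Num.real by rewrite realN.
have NH : - H = sdiag W (fun i => - d i) by rewrite sdiagN eH.
have half_real : 1 / 2 \is @Num.real R[i].
  by rewrite realM ?realV ?realn ?real1.
have AB : condA -> condB.
  move=> hA j; apply: hA; last exact: psdmx_outer.
  rewrite /basis_vec trmx_delta map_delta_mx mul_delta_mx.
  apply/is_diag_mxP => i k ik; rewrite mxE.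
  have [eij|//] := eqVneq i j; have [ekj|//] := eqVneq k j.
  by rewrite eij ekj eqxx in ik.
have BC : condB -> condC.
  move=> hB j; split.
    rewrite posE real_leNgt ?half_real ?sdiag_diag_real //.
    apply/negP => /(trace_norm_add_outer_lt uW NdR)[l l0].
    rewrite -NH trace_normN -trace_normN opprD opprK.
    (* The lemma raises [- H] by [l], which lowers [H] by [l]. As [l] is positive in [R[i]], it is
       real and equals its real part. *)
    have := hB j (- complex.Re l).
    rewrite rmorphN /= RRe_real ?gtr0_real // scaleNr => h1 h2.
    by have := le_lt_trans h1 h2; rewrite ltxx.
  rewrite negE real_leNgt ?half_real ?sdiag_diag_real //.
  apply/negP => /(trace_norm_add_outer_lt uW dR)[l l0].
  rewrite -eH.
  have := hB j (complex.Re l).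
  rewrite RRe_real ?gtr0_real // => h1 h2.
  by have := le_lt_trans h1 h2; rewrite ltxx.
have CA : condC -> condA.
  move=> hC D dD pD l; have [l0|l0] := leP 0 l.
    rewrite eH; apply: trace_norm_add_diag_ge => //; last by rewrite lecR.
    by move=> j; rewrite -negE; have [] := hC j.
  (* For negative [l], both sides are negated, turning the perturbation into [- H] plus a positive
     multiple of [D]. *)
  rewrite -trace_normN -[leRHS]trace_normN opprD -scaleNr -rmorphN NH.
  apply: trace_norm_add_diag_ge => //; last by rewrite lecR oppr_ge0 ltW.
  by move=> j; rewrite -posE; have [] := hC j.
by split; split => //; auto.
Qed.
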